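(* Let $\mathbb{F}$ be a field and let $\ominus$ be a uniform Kronecker difference over $\mathbb{F}$. Let $(\upsilon_n)_{n\in\mathbb{N}}$, $\upsilon_n\in\mathbb{F}_n$, be a given sequence with $\operatorname{tr}(\upsilon_n)=1$ that represents $\ominus$ (in the sense described in the context). Then there exist unique matrices $\gamma_{m,n}\in\mathbb{F}_m\otimes\mathbb{F}_n\otimes\mathbb{F}_m=\mathbb{F}_{m^2n}$, $m,n\in\mathbb{N}$, with $\operatorname{tr}_1(\gamma_{m,n})=0$ and $\operatorname{tr}_2(\gamma_{m,n})=0$ and $$A\ominus B=\operatorname{tr}_{12}\bigl(\alpha_{m,n}^T(A\otimes I_m-I_m\otimes B\otimes I_m)\bigr),\qquad \alpha_{m,n}:=\sum_{i,j=1}^m E_{ij}\otimes\upsilon_n\otimes E_{ji}+\gamma_{m,n},$$ for all $A\in\mathbb{F}_m\otimes\mathbb{F}_n$, $B\in\mathbb{F}_n$ and $m,n\in\mathbb{N}$.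
   Context: $\mathbb{F}_m$ is the space of $m\times m$ matrices over $\mathbb{F}$, $\mathbb{N}$ is the set of positive integers, $\otimes$ is the Kronecker product, and $\mathbb{F}_m\otimes\mathbb{F}_n$ is identified with $\mathbb{F}_{mn}$. $E_{ij}$ is the matrix unit with a $1$ in position $(i,j)$ and zeros elsewhere (here of size $m\times m$), and $I_m$ is the identity matrix. The Kronecker sum of $A\in\mathbb{F}_m$ and $B\in\mathbb{F}_n$ is $A\oplus B=A\otimes I_n+I_m\otimes B$. A Kronecker difference is a family of operations $\ominus:\mathbb{F}_{mn}\times\mathbb{F}_n\to\mathbb{F}_m$, indexed by $m,n\in\mathbb{N}$, such that $(A\oplus B)\ominus B=A$ for all $A\in\mathbb{F}_m$, $B\in\mathbb{F}_n$, $m,n\in\mathbb{N}$. It is uniform if $(A\oplus C)\ominus B=A\oplus(C\ominus B)$ for all $A\in\mathbb{F}_m$, $B\in\mathbb{F}_n$, $C\in\mathbb{F}_p\otimes\mathbb{F}_n$ and $m,n,p\in\mathbb{N}$, and moreover $(A+B)\ominus(C+D)=(A\ominus C)+(B\ominus D)$ and $(kA)\ominus(kC)=k(A\ominus C)$ for all matrices $A,B,C,D$ and scalars $k\in\mathbb{F}$ whenever the operations are defined. On $\mathbb{F}_m\otimes\mathbb{F}_n\otimes\mathbb{F}_m$ the following maps are defined by linear extension: $\operatorname{tr}_1(A\otimes B\otimes C)=\operatorname{tr}(A)\,B\otimes C$, $\operatorname{tr}_2(A\otimes B\otimes C)=\operatorname{tr}(B)\,A\otimes C$, $\operatorname{tr}_{12}(A\otimes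 B\otimes C)=\operatorname{tr}(A)\operatorname{tr}(B)\,C$. A sequence $(\upsilon_n)$ with $\upsilon_n\in\mathbb{F}_n$, $\operatorname{tr}(\upsilon_n)=1$, represents $\ominus$ if for all $m,n\in\mathbb{N}$ there is some $\gamma_{m,n}\in\mathbb{F}_m\otimes\mathbb{F}_n\otimes\mathbb{F}_m$ with $\operatorname{tr}_1(\gamma_{m,n})=0$, $\operatorname{tr}_2(\gamma_{m,n})=0$ such that $A\ominus B=\operatorname{tr}_{12}(\alpha_{m,n}^T(A\otimes I_m-I_m\otimes B\otimes I_m))$ for all $A\in\mathbb{F}_m\otimes\mathbb{F}_n$, $B\in\mathbb{F}_n$, where $\alpha_{m,n}=\sum_{i,j=1}^mE_{ij}\otimes\upsilon_n\otimes E_{ji}+\gamma_{m,n}$. Every uniform Kronecker difference is represented by such a sequence. *)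

(* Defs.v *)
From mathcomp Require Import all_boot all_algebra.
From mathcomp.real_closed Require Export mxtens.

Set Implicit Arguments.
Unset Strict Implicit.
Unset Printing Implicit Defensive.

Import GRing.Theory.
Local Open Scope ring_scope.

(* The identification of the tensor product of 'M_m and 'M_n with 'M_(m * n)
   is the one of [tensmx], notation [A *t B]: the pair (i, j) is the index
   i * n + j, that is [mxtens_index (i, j)].  Triple products are associated
   to the left, so they live in 'M_(m * n * p). *)

Definition kronsum (F : fieldType) (m n : nat) (A : 'M[F]_m) (B : 'M[F]_n) :
    'M[F]_(m * n) :=
  A *t (1%:M : 'M[F]_n) + (1%:M : 'M[F]_m) *t B.

(* [castmx] along [mulnA] keeps the numerical indices, and it is the
   associativity of the Kronecker product. *)
Definition tens_assoc (F : fieldType) (m n p : nat) (X : 'M[F]_(m * (n * p))) :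
    'M[F]_(m * n * p) :=
  castmx (mulnA m n p, mulnA m n p) X.

Lemma mxtens_indexA (m n p : nat) (i : 'I_m) (j : 'I_n) (k : 'I_p) :
  cast_ord (esym (mulnA m n p)) (mxtens_index (mxtens_index (i, j), k)) =
  mxtens_index (i, mxtens_index (j, k)).
Proof. by apply: val_inj => /=; rewrite mulnDl addnA mulnA. Qed.

Lemma tens_assoc_tens (F : fieldType) (m n p : nat)
    (A : 'M[F]_m) (B : 'M[F]_n) (C : 'M[F]_p) :
  tens_assoc (A *t (B *t C)) = A *t B *t C.
Proof.
apply/matrixP => a b; rewrite castmxE.
case: (mxtens_indexP a) => a1 k; case: (mxtens_indexP a1) => i j {a a1}.
case: (mxtens_indexP b) => b1 k'; case: (mxtens_indexP b1) => i' j' {b b1}.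
by rewrite !mxtens_indexA !tensmxE mulrA.
Qed.

(* The partial traces are given by their entries; they are linear, with the
   expected values on pure tensors (lemmas [ptr*_linear] and [ptr*_tens]), and
   pure tensors span the space (lemma [tens_span]). *)
Definition ptr1 (F : fieldType) (m n p : nat) (X : 'M[F]_(m * n * p)) :
    'M[F]_(n * p) :=
  \matrix_(a, b) \sum_(i < m)
    X (mxtens_index (mxtens_index (i, (mxtens_unindex a).1),
                     (mxtens_unindex a).2))
      (mxtens_index (mxtens_index (i, (mxtens_unindex b).1),
                     (mxtens_unindex b).2)).

Definition ptr2 (F : fieldType) (m n p : nat) (X : 'M[F]_(m * n * p)) :
    'M[F]_(m * p) :=
  \matrix_(a, b) \sum_(j < n)
    X (mxtens_index (mxtens_index ((mxtens_unindex a).1, j),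
                     (mxtens_unindex a).2))
      (mxtens_index (mxtens_index ((mxtens_unindex b).1, j),
                     (mxtens_unindex b).2)).

Definition ptr12 (F : fieldType) (m n p : nat) (X : 'M[F]_(m * n * p)) :
    'M[F]_p :=
  \matrix_(k, l) \sum_(i < m) \sum_(j < n)
    X (mxtens_index (mxtens_index (i, j), k))
      (mxtens_index (mxtens_index (i, j), l)).

Lemma ptr1_linear (F : fieldType) (m n p : nat) : linear (@ptr1 F m n p).
Proof.
move=> c X Y; apply/matrixP => a b; rewrite !mxE mulr_sumr -big_split /=.
by apply: eq_bigr => i _; rewrite !mxE.
Qed.

Lemma ptr2_linear (F : fieldType) (m n p : nat) : linear (@ptr2 F m n p).
Proof.
move=> c X Y; apply/matrixP => a b; rewrite !mxE mulr_sumr -big_split /=.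
by apply: eq_bigr => i _; rewrite !mxE.
Qed.

Lemma ptr12_linear (F : fieldType) (m n p : nat) : linear (@ptr12 F m n p).
Proof.
move=> c X Y; apply/matrixP => a b; rewrite !mxE mulr_sumr -big_split /=.
apply: eq_bigr => i _; rewrite mulr_sumr -big_split /=.
by apply: eq_bigr => j _; rewrite !mxE.
Qed.

Lemma ptr1_tens (F : fieldType) (m n p : nat)
    (A : 'M[F]_m) (B : 'M[F]_n) (C : 'M[F]_p) :
  ptr1 (A *t B *t C) = \tr A *: (B *t C).
Proof.
apply/matrixP => a b; case: (mxtens_indexP a) => j k {a}.
case: (mxtens_indexP b) => j' k' {b}.
rewrite !mxE !mxtens_indexK /= mulr_suml; apply: eq_bigr => i _.
by rewrite !tensmxE mulrA.
Qed.

Lemma ptr2_tens (F : fieldType) (m n p : nat)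
    (A : 'M[F]_m) (B : 'M[F]_n) (C : 'M[F]_p) :
  ptr2 (A *t B *t C) = \tr B *: (A *t C).
Proof.
apply/matrixP => a b; case: (mxtens_indexP a) => j k {a}.
case: (mxtens_indexP b) => j' k' {b}.
rewrite !mxE !mxtens_indexK /= mulr_suml; apply: eq_bigr => i _.
by rewrite !tensmxE mulrA (mulrC (A _ _)).
Qed.

Lemma ptr12_tens (F : fieldType) (m n p : nat)
    (A : 'M[F]_m) (B : 'M[F]_n) (C : 'M[F]_p) :
  ptr12 (A *t B *t C) = (\tr A * \tr B) *: C.
Proof.
apply/matrixP => k l; rewrite !mxE !mulr_suml; apply: eq_bigr => i _.
rewrite mulr_sumr mulr_suml; apply: eq_bigr => j _.
by rewrite !tensmxE.
Qed.

Lemma delta_tens (F : fieldType) (m n : nat) (i i' : 'I_m) (j j' : 'I_n) :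
  delta_mx (mxtens_index (i, j)) (mxtens_index (i', j')) =
  (delta_mx i i' : 'M[F]_m) *t (delta_mx j j' : 'M[F]_n).
Proof.
apply/matrixP => a b; case: (mxtens_indexP a) => k l {a}.
case: (mxtens_indexP b) => k' l' {b}.
rewrite tensmxE !mxE !(can_eq (@mxtens_indexK _ _)) !xpair_eqE -natrM mulnb.
by rewrite andbACA.
Qed.

Lemma tens_span (F : fieldType) (m n p : nat) (X : 'M[F]_(m * n * p)) :
  X = \sum_a \sum_b X a b *:
    ((delta_mx (mxtens_unindex (mxtens_unindex a).1).1
               (mxtens_unindex (mxtens_unindex b).1).1 : 'M[F]_m)
     *t (delta_mx (mxtens_unindex (mxtens_unindex a).1).2
                  (mxtens_unindex (mxtens_unindex b).1).2 : 'M[F]_n)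
     *t (delta_mx (mxtens_unindex a).2 (mxtens_unindex b).2 : 'M[F]_p)).
Proof.
rewrite {1}[X]matrix_sum_delta; apply: eq_bigr => a _; apply: eq_bigr => b _.
have idxK k l (x : 'I_(k * l)) :
    mxtens_index ((mxtens_unindex x).1, (mxtens_unindex x).2) = x.
  by rewrite -[RHS]mxtens_unindexK; congr mxtens_index.
by rewrite -!delta_tens !idxK.
Qed.

(* Sizes range over the positive integers: everywhere below the members of a
   family at size 0 exist but are left unconstrained. *)
Definition kron_op (F : fieldType) : Type :=
  forall m n : nat, 'M[F]_(m * n) -> 'M[F]_n -> 'M[F]_m.

Definition kron_diff (F : fieldType) (D : kron_op F) : Prop :=
  forall m n : nat, (0 < m)%N -> (0 < n)%N ->
  forall (A : 'M[F]_m) (B : 'M[F]_n), D m n (kronsum A B) B = A.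

Record uniform_kron_diff (F : fieldType) (D : kron_op F) : Prop :=
  UniformKronDiff {
    ukd_kron_diff : kron_diff D;
    ukd_assoc : forall m n p : nat, (0 < m)%N -> (0 < n)%N -> (0 < p)%N ->
      forall (A : 'M[F]_m) (B : 'M[F]_n) (C : 'M[F]_(p * n)),
      D (m * p)%N n (tens_assoc (kronsum A C)) B = kronsum A (D p n C B);
    ukd_add : forall m n : nat, (0 < m)%N -> (0 < n)%N ->
      forall (A B : 'M[F]_(m * n)) (C E : 'M[F]_n),
      D m n (A + B) (C + E) = D m n A C + D m n B E;
    ukd_scale : forall m n : nat, (0 < m)%N -> (0 < n)%N ->
      forall (k : F) (A : 'M[F]_(m * n)) (C : 'M[F]_n),
      D m n (k *: A) (k *: C) = k *: D m n A C
  }.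

Definition kron_alpha (F : fieldType) (m n : nat)
    (u : 'M[F]_n) (g : 'M[F]_(m * n * m)) : 'M[F]_(m * n * m) :=
  \sum_(i < m) \sum_(j < m)
    (delta_mx i j : 'M[F]_m) *t u *t (delta_mx j i : 'M[F]_m) + g.

Definition repr_at (F : fieldType) (D : kron_op F) (m n : nat)
    (u : 'M[F]_n) (g : 'M[F]_(m * n * m)) : Prop :=
  [/\ ptr1 g = 0, ptr2 g = 0
    & forall (A : 'M[F]_(m * n)) (B : 'M[F]_n),
      D m n A B =
      ptr12 ((kron_alpha u g)^T *m
             (A *t (1%:M : 'M[F]_m)
              - (1%:M : 'M[F]_m) *t B *t (1%:M : 'M[F]_m)))].

Definition represents (F : fieldType) (D : kron_op F)
    (u : forall n : nat, 'M[F]_n) : Prop :=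
  (forall n : nat, (0 < n)%N -> \tr (u n) = 1) /\
  (forall m n : nat, (0 < m)%N -> (0 < n)%N ->
     exists g : 'M[F]_(m * n * m), repr_at D (u n) g).

(* Main.v *)
Require Import Defs.
From mathcomp Require Import all_boot all_algebra.

(* Taking [B = 0] and [A] a matrix unit, the entries of [D m n A 0] are exactly
   the entries of [kron_alpha u g].  Hence [g] is given by a formula in [D] and
   [u], which also spares a choice of one [g] for each pair of sizes. *)

Set Implicit Arguments.
Unset Strict Implicit.
Unset Printing Implicit Defensive.

Import GRing.Theory.
Local Open Scope ring_scope.

(** Pairing with a matrix unit isolates one entry of [X]; the transpose is what puts [l] in the row
    index and [k] in the column index. *)
Lemma ptr12_trmul_delta (F : fieldType) (m n p : nat) (X : 'M[F]_(m * n * p))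
    (a b : 'I_(m * n)) (k l : 'I_p) :
  ptr12 (X^T *m (delta_mx a b *t (1%:M : 'M[F]_p))) k l =
  X (mxtens_index (a, l)) (mxtens_index (b, k)).
Proof.
have entry (x : 'I_(m * n)) :
    (X^T *m (delta_mx a b *t (1%:M : 'M[F]_p)))
      (mxtens_index (x, k)) (mxtens_index (x, l)) =
    X (mxtens_index (a, l)) (mxtens_index (x, k)) *+ (x == b).
  (* Column [(x, l)] of the right factor vanishes outside row [(a, l)]. *)
  rewrite mxE (bigD1 (mxtens_index (a, l))) //= big1 ?addr0 => [|y].
    by rewrite mxE tensmxE !mxE !eqxx mulr1 mulr_natr.
  case: (mxtens_indexP y) => y1 y2.
  rewrite (can_eq (@mxtens_indexK _ _)) xpair_eqE tensmxE !mxE => ne.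
  by move: ne; case: eqP => _ /=; [case: eqP|]; rewrite ?mul0r ?mulr0.
(* Splitting [b] as [(b1, b2)] matches the double sum of [ptr12], of which only that term
   survives. *)
rewrite mxE; case: (mxtens_indexP b) entry => b1 b2 entry.
rewrite (bigD1 b1) //= (bigD1 b2) //= entry eqxx !big1 ?addr0 //.
  move=> i ne_i; apply: big1 => j _.
  by rewrite entry (can_eq (@mxtens_indexK _ _)) xpair_eqE (negPf ne_i).
move=> j ne_j.
by rewrite entry (can_eq (@mxtens_indexK _ _)) xpair_eqE (negPf ne_j) andbF.
Qed.

(** The first matrix recovers the whole of [kron_alpha u g]; [kron_alpha u 0] is its part
    independent of [g]. *)
Definition kron_gamma (F : fieldType) (D : kron_op F) (m n : nat)
    (u : 'M[F]_n) : 'M[F]_(m * n * m) :=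
  \matrix_(s, t)
    D m n (delta_mx (mxtens_unindex s).1 (mxtens_unindex t).1) 0
      (mxtens_unindex t).2 (mxtens_unindex s).2
  - kron_alpha u 0.

Lemma repr_at_gamma (F : fieldType) (D : kron_op F) (m n : nat)
    (u : 'M[F]_n) (g : 'M[F]_(m * n * m)) :
  repr_at D u g -> g = kron_gamma D m u.
Proof.
case=> _ _ DE.
have gE : g = kron_alpha u g - kron_alpha u 0.
  by rewrite /kron_alpha addr0 addrC addKr.
rewrite {1}gE /kron_gamma; congr (_ - _).
apply/matrixP => s t.
case: (mxtens_indexP s) => a l; case: (mxtens_indexP t) => b k.
by rewrite [RHS]mxE !mxtens_indexK /= DE tensmx0 tens0mx subr0 ptr12_trmul_delta.
Qed.

Theorem corollary1 (F : fieldType) (D : kron_op F)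
    (upsilon : forall n : nat, 'M[F]_n) :
  uniform_kron_diff D ->
  represents D upsilon ->
  exists gamma : forall m n : nat, 'M[F]_(m * n * m),
    forall m n : nat, (0 < m)%N -> (0 < n)%N ->
      repr_at D (upsilon n) (gamma m n) /\
      (forall g : 'M[F]_(m * n * m),
         repr_at D (upsilon n) g -> g = gamma m n).
Proof.
move=> _ [_ repD]; exists (fun m n => kron_gamma D m (upsilon n)) => m n m0 n0.
split=> [|g]; last exact: repr_at_gamma.
(* Some [g] represents [D] at these sizes and equals the formula, so the formula inherits both trace
   conditions. *)
by have [g rg] := repD m n m0 n0; rewrite -(repr_at_gamma rg).
Qed.
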